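(* Let $p$ be a prime and $q=1/p$. For integers $n\ge 1$ and $\mu\ge 1$, let $Q(n,p^\mu)$ denote the probability that a random symmetric $n\times n$ matrix $A$ over $\mathbf{Z}_{p^\mu}$ satisfies $\det(A)\equiv 0 \pmod{p^\mu}$. Let $k=\lfloor n/2\rfloor$ and $s=\lfloor(\mu-1)/2\rfloor$. Then $$Q(n,p^\mu)=\frac{q^\mu(1-q^n)-R}{1-q},$$ where $$R=q^{s+1}\sum_{j=0}^{k-1}\Big(q^\mu(1-q^n)-q^{2s+2}(1-q^{2j+1})\Big)\,q^{2j}\,\frac{\Pi_{2j}(q)\,\Pi_{j+s}(q^2)}{\Pi_j(q^2)^2\,\Pi_s(q^2)},$$ and $0\le R<q^{3\mu/2}$.
   Context: For a positive integer $m$, $\mathbf{Z}_m=\{1,2,\ldots,m\}$ (viewed as residues mod $m$). A random symmetric $n\times n$ matrix over $\mathbf{Z}_m$ is one whose entries $a_{ij}$, $i\le j$, are chosen independently and uniformly from $\mathbf{Z}_m$, with $a_{ji}=a_{ij}$. For $n\ge 0$, $\Pi_n(q)=\prod_{j=1}^n(1-q^j)$ (so $\Pi_0=1$). *)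

(* Defs.v *)
From HB Require Import structures.
From mathcomp Require Import all_boot all_order all_algebra.
Set Implicit Arguments. Unset Strict Implicit. Unset Printing Implicit Defensive.
Import Order.TTheory GRing.Theory Num.Theory.
Local Open Scope ring_scope.

Definition Pi (R : nzRingType) (n : nat) (x : R) : R :=
  \prod_(1 <= j < n.+1) (1 - x ^+ j).

(* Q(n, m): probability that a uniformly random symmetric n x n matrix over
   Z/mZ has determinant 0 in Z/mZ (i.e. det = 0 mod m).  Choosing the entries
   a_ij (i <= j) independently and uniformly is the same as choosing a
   symmetric matrix uniformly.  Requires m >= 2 ('Z_m). *)
Definition symQ (R : fieldType) (n m : nat) : R :=
  (#|[set A : 'M['Z_m]_n | (A^T == A) && (\det A == 0)]|)%:R /
  (#|[set A : 'M['Z_m]_n | A^T == A]|)%:R.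

(* Main.v *)
(* Work in L = Z/p^mu, and let x_n(j) be the probability that p^j divides det A, for A uniform
   symmetric n x n.  Allow matrices whose rows and columns beyond the m-th have entries in pL, and
   peel off one row: if the diagonal entry is a unit, take its Schur complement; otherwise, if
   another entry of the row is a unit, the Schur complement of a 2 x 2 block; otherwise the row
   joins those in pL.  When all entries are in pL, A = pB and det A = p^n det B.  This gives
     x_n(j) = sum_c P(n,c) x_c(j-c),   P(n,c) = Pr(corank of A mod p is c),
   where truncated subtraction is right because x_c(0) = 1.  By induction on j alone, this
   convolution identity yields two recurrences
     x_n(j) = (1-q^n) x_{n-1}(j) + q^n x_n(j-1)         (n odd),
     x_n(j) = q^n x_n(j-2) + (1-q^n) x_{n-2}(j)         (n odd, n > 1),
   the first of which also determines x_{n-1} from x_n.  For n odd they say that the valuation of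
   det A is G + 2W, with G geometric of parameter q and W a sum of independent geometric variables
   of parameters q^3, q^5, ..., q^n; tilting W into W' with parameters q, q^3, ..., q^(n-2) gives
     (1-q) x_n(mu) = q^mu (1-q^n) Pr(W' <= s) + (1-q) Pr(W > s).
   For n even the same holds with W and W' taken from n+1.  The sum over j in R is the
   expansion of Pr(W' > s) and Pr(W > s) in the number of summands. *)
Require Import Defs.
From HB Require Import structures.
From mathcomp Require Import all_boot all_order all_algebra all_fingroup.
From mathcomp Require Import ring lra zify.
Set Implicit Arguments. Unset Strict Implicit. Unset Printing Implicit Defensive.
Import Order.TTheory GRing.Theory Num.Theory.
Local Open Scope ring_scope.

(** * Counting degenerate symmetric matrices over a finite local ring *)

Section LocalRing.
Variable L : finComUnitRingType.
Local Notation nonunit x := (x \isn't a GRing.unit).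
Hypothesis nonunitD : forall x y : L, nonunit x -> nonunit y -> nonunit (x + y).
Implicit Types (c : L).

Lemma nonunitMl (x y : L) : nonunit x -> nonunit (x * y).
Proof. by rewrite unitrM negb_and => ->. Qed.

Lemma nonunit0 : nonunit (0 : L).
Proof. by rewrite unitr0. Qed.

Lemma nonunitN (x : L) : nonunit (- x) = nonunit x.
Proof. by rewrite unitrN. Qed.

Lemma nonunit_sum (I : finType) (F : I -> L) :
  (forall i, nonunit (F i)) -> nonunit (\sum_i F i).
Proof.
by move=> hF; apply: (big_ind (fun x : L => nonunit x)) => //; exact: nonunit0.
Qed.

(* Symmetric matrices whose rows (hence columns) of index at least m have entries in the
   maximal ideal, and whose determinant is killed by c. *)
Definition degsym n m c : {set 'M[L]_n} :=
  [set A | [&& A^T == A,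
     [forall i : 'I_n, (m <= i)%N ==> [forall j, nonunit (A i j)]] & c * \det A == 0]].

Lemma degsymP n m c (A : 'M[L]_n) :
  reflect [/\ A^T = A, forall i j : 'I_n, (m <= i)%N -> nonunit (A i j) & c * \det A = 0]
    (A \in degsym n m c).
Proof.
rewrite inE; apply: (iffP and3P) => -[].
  move=> /eqP-> /forallP h /eqP->; split=> // i j ij.
  by have /implyP /(_ ij) /forallP := h i; apply.
move=> -> h ->; split=> //; apply/forallP=> i; apply/implyP=> ij.
by apply/forallP=> j; exact: h.
Qed.

Lemma det_schur n k (P : 'M[L]_k) (C : 'M[L]_(n, k)) (B : 'M[L]_n) : P \in unitmx ->
  \det (block_mx P C^T C B) = \det P * \det (B - C *m invmx P *m C^T).
Proof.
move=> uP.
have -> : block_mx P C^T C B =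
    block_mx 1%:M 0 (C *m invmx P) 1%:M *m block_mx P C^T 0 (B - C *m invmx P *m C^T).
  rewrite mulmx_block !mul1mx !mul0mx !addr0.
  by rewrite -mulmxA mulVmx // mulmx1 addrC subrK.
by rewrite det_mulmx det_lblock det_ublock !det1 !mul1r.
Qed.

(** Once the first [k] columns are fixed with an invertible pivot block, the Schur complement ranges
    bijectively over the smaller set: the determinants differ by a unit factor, and the correction
    [S] inherits its nonunit rows from [C]. *)
Lemma card_schur n k m c (K : 'M[L]_(k + n, k)) :
  (usubmx K)^T = usubmx K -> usubmx K \in unitmx ->
  (forall (i : 'I_(k + n)) j, (k + m <= i)%N -> nonunit (K i j)) ->
  #|[set A in degsym (k + n) (k + m) c | lsubmx A == K]| = #|degsym n m c|.
Proof.
set P := usubmx K; set C := dsubmx K => symP uP hK.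
have hC (i : 'I_n) j : (m <= i)%N -> nonunit (C i j).
  by move=> mi; rewrite mxE; apply: hK; rewrite /= leq_add2l.
set S := C *m invmx P *m C^T.
have symS : S^T = S by rewrite !trmx_mul trmxK trmx_inv symP mulmxA.
have hS (i : 'I_n) j : (m <= i)%N -> nonunit (S i j).
  move=> mi; rewrite /S -mulmxA mxE; apply: nonunit_sum => l.
  exact/nonunitMl/hC.
pose f (B : 'M[L]_n) := block_mx P C^T C (B + S).
have injf : injective f by move=> B B' /eq_block_mx[_ _ _] /addIr.
rewrite -(card_imset _ injf); apply: eq_card => A; rewrite [in LHS]inE.
apply/andP/imsetP => [[/degsymP[sA hA dA] /eqP eK]|[B /degsymP[sB hB dB] ->]].
  have eA : A = block_mx P C^T C (drsubmx A).
    rewrite -[A in LHS]submxK /P /C -eK; congr block_mx; apply/matrixP=> i j; rewrite !mxE //.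
    by rewrite -[in LHS]sA mxE.
  exists (drsubmx A - S); last by rewrite /f subrK.
  apply/degsymP; split.
  - by rewrite linearB /= symS trmx_drsub sA.
  - move=> i j mi; rewrite mxE [(- S) i j]mxE nonunitD ?nonunitN ?hS // !mxE hA //.
    by rewrite leq_add2l.
  - have uD : \det P \is a GRing.unit by rewrite unitmxE in uP.
    by move: dA; rewrite {1}eA det_schur // mulrCA => h; apply: (mulrI uD); rewrite mulr0; exact: h.
split; last first.
  by rewrite /f block_mxEh row_mxKl /P /C vsubmxK.
apply/degsymP; split.
- by rewrite /f tr_block_mx symP trmxK linearD /= sB symS.
- move=> i j; rewrite /f -(splitK i) -(splitK j).
  case: (split i) => i'; case: (split j) => j' /=.
  + by move=> h; have := ltn_ord i'; rewrite ltnNge (leq_trans (leq_addr _ _) h).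
  + by move=> h; have := ltn_ord i'; rewrite ltnNge (leq_trans (leq_addr _ _) h).
  + by rewrite leq_add2l block_mxEdl => /hC.
  + by rewrite leq_add2l block_mxEdr mxE => mi; rewrite nonunitD ?hB ?hS.
- by rewrite /f det_schur // addrK mulrCA dB mulr0.
Qed.
End LocalRing.

(** * Counting by fibres and by coordinates *)

Lemma card_fibers (T I : finType) (D : {set T}) (f : T -> I) (Q : {set I}) N :
  (forall A, A \in D -> f A \in Q) ->
  (forall i, i \in Q -> #|[set A in D | f A == i]| = N) -> #|D| = (#|Q| * N)%N.
Proof.
move=> fQ hN; rewrite -sum1_card (partition_big f (mem Q)) //=.
rewrite -sum_nat_const; apply: eq_bigr => i Qi; rewrite -(hN i Qi) -sum1_card.
by apply: eq_bigl => A; rewrite inE.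
Qed.

Lemma card_cV (T : finType) n (X : 'I_n -> pred T) :
  #|[set v : 'cV[T]_n | [forall i, X i (v i 0)]]| = (\prod_i #|X i|)%N.
Proof.
have := @card_family 'I_n (fun=> T) X.
rewrite foldrE big_map big_enum /= => <-.
pose f (g : {ffun 'I_n -> T}) : 'cV[T]_n := \col_i g i.
have injf : injective f.
  by move=> g h /matrixP e; apply/ffunP=> i; have := e i 0; rewrite !mxE.
rewrite -(card_imset _ injf); apply: eq_card => v; rewrite inE.
apply/forallP/imsetP => [h|[g /familyP gX -> i]]; last by rewrite mxE; exact: gX.
exists [ffun i => v i 0]; first by apply/familyP=> i; rewrite ffunE; exact: h.
by apply/matrixP=> i j; rewrite !mxE ffunE ord1.
Qed.

(** * Simultaneous permutation of rows and columns *)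

Section Permutation.
Variables (L : finComUnitRingType) (n : nat) (s : {perm 'I_n}).

Definition conj_perm (A : 'M[L]_n) := row_perm s (col_perm s A).

Lemma conj_permE A i j : conj_perm A i j = A (s i) (s j).
Proof. by rewrite !mxE. Qed.

Lemma det_conj_perm A : \det (conj_perm A) = \det A.
Proof.
rewrite /conj_perm row_permE col_permE !det_mulmx !det_perm odd_permV.
by rewrite mulrC -mulrA -signr_addb addbb mulr1.
Qed.

Lemma conj_perm_inj : injective conj_perm.
Proof.
move=> A B /matrixP e; apply/matrixP=> i j.
by have := e (s^-1 i)%g (s^-1 j)%g; rewrite !mxE !permKV.
Qed.

Lemma conj_perm_sym A : ((conj_perm A)^T == conj_perm A) = (A^T == A).
Proof.
rewrite -[RHS](inj_eq conj_perm_inj); congr (_ == _).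
by apply/matrixP=> i j; rewrite mxE !conj_permE mxE.
Qed.

Lemma card_conj_perm (D D' : {set 'M[L]_n}) :
  (forall A, (conj_perm A \in D) = (A \in D')) -> #|D'| = #|D|.
Proof.
move=> h; rewrite -(card_preimset D conj_perm_inj).
by apply: eq_card => A; rewrite [in RHS]inE h.
Qed.
End Permutation.

(** * Peeling off the first row *)

Section Recursion.
Variable L : finComUnitRingType.
Local Notation nonunit x := (x \isn't a GRing.unit).
Hypothesis nonunitD : forall x y : L, nonunit x -> nonunit y -> nonunit (x + y).
Implicit Types (c : L).
Local Notation l := #|L|.
Local Notation v := #|[pred x : L | nonunit x]|.
Local Notation u := #|[pred x : L | x \is a GRing.unit]|.

Lemma card_units : (u + v = l)%N.
Proof. by rewrite -(cardC [pred x : L | x \is a GRing.unit]); congr addn; apply: eq_card. Qed.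

Lemma prod_card_cond n m (X : 'I_n -> pred L) : (m <= n)%N ->
  (forall i : 'I_n, X i =i [pred x : L | (m <= i)%N ==> nonunit x]) ->
  (\prod_i #|X i| = l ^ m * v ^ (n - m))%N.
Proof.
move=> mn hX.
transitivity (\prod_(i < n) (if (i < m)%N then l else v))%N.
  apply: eq_bigr => i _; rewrite (eq_card (hX i)) ltnNge.
  by case: (leqP m i) => h /=; apply: eq_card.
rewrite -(big_mkord xpredT (fun i => if (i < m)%N then l else v)).
rewrite (big_cat_nat (leq0n m) mn) /=; congr muln.
  rewrite big_nat (eq_bigr (fun=> l)) -?big_nat ?prod_nat_const_nat ?subn0 //.
  by move=> i /andP[_ ->].
rewrite big_nat (eq_bigr (fun=> v)) -?big_nat ?prod_nat_const_nat //.
by move=> i /andP[h _]; rewrite ltnNge h.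
Qed.

Lemma card_col_cond n m (Y : pred L) : (m <= n)%N ->
  #|[set w : 'cV[L]_(1 + n) | Y (w 0 0) &
      [forall i : 'I_(1 + n), (1 + m <= i)%N ==> nonunit (w i 0)]]| =
  (#|Y| * (l ^ m * v ^ (n - m)))%N.
Proof.
move=> mn.
pose X (i : 'I_(1 + n)) : pred L :=
  [pred x | ((i == 0) ==> Y x) && ((1 + m <= i)%N ==> nonunit x)].
transitivity #|[set w : 'cV[L]_(1 + n) | [forall i, X i (w i 0)]]|.
  apply: eq_card => w; rewrite !inE; apply/andP/forallP => [[h0 /forallP h] i|h].
    by rewrite /X /= h andbT; apply/implyP=> /eqP->.
  split; first by have /andP[] := h 0.
  by apply/forallP=> i; have /andP[] := h i.
rewrite card_cV big_ord_recl; congr muln.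
  by apply: eq_card => x; rewrite !inE /= andbT.
by apply: prod_card_cond => // i x; rewrite !inE /=.
Qed.

Lemma card_degsym_pivot1 n m c : (m <= n)%N ->
  #|[set A in degsym (1 + n) (1 + m) c | A 0 0 \is a GRing.unit]| =
  (u * (l ^ m * v ^ (n - m)) * #|degsym n m c|)%N.
Proof.
move=> mn; rewrite -(card_col_cond _ mn).
apply: (card_fibers (f := fun A : 'M_(1 + n) => lsubmx A)).
  move=> A /setIdP[/degsymP[_ hA _] h0]; rewrite inE /=.
  rewrite mxE lshift0 h0; apply/forallP=> i; apply/implyP=> hi; rewrite mxE.
  exact: hA.
move=> K; rewrite inE => /andP[/= K0 /forallP hK].
rewrite -(card_schur nonunitD (k := 1) c (K := K)).
- apply: eq_card => A; rewrite !inE; case: (lsubmx A =P K) => e; rewrite ?andbF // !andbT.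
  have -> : A 0 0 \is a GRing.unit by have := K0; rewrite -e mxE lshift0.
  by rewrite andbT.
- by apply/matrixP=> i j; rewrite !mxE !ord1.
- by rewrite unitmxE det_mx11 mxE lshift0.
- by move=> i j hi; rewrite ord1; have /implyP := hK i; apply.
Qed.

(** A first row of nonunits is exchanged with row [m], so that the restricted rows again form a
    final segment. *)
Lemma card_degsym_row0 n m c : (m <= n)%N ->
  #|[set A in degsym n.+1 m.+1 c | [forall j, nonunit (A 0 j)]]| = #|degsym n.+1 m c|.
Proof.
move=> mn; pose o : 'I_n.+1 := inord m.
have om : o = m :> nat by rewrite inordK.
apply/esym/(@card_conj_perm _ _ (tperm 0 o)) => A.
rewrite [LHS]inE; apply/andP/degsymP => [[/degsymP[/eqP sA hA dA] /forallP h0]|[sA hA dA]].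
  move: sA dA; rewrite conj_perm_sym det_conj_perm => /eqP sA dA; split=> // i j mi.
  have [e|ne] := eqVneq i o.
    by have := h0 (tperm 0 o j); rewrite conj_permE tpermL tpermK e.
  have := hA (tperm 0 o i) (tperm 0 o j); rewrite conj_permE !tpermK; apply.
  have mi' : (m < i)%N.
    by rewrite ltn_neqAle mi andbT -om eq_sym (inj_eq val_inj).
  by rewrite tpermD // eq_sym // -val_eqE /= -lt0n (leq_ltn_trans _ mi').
split; last by apply/forallP=> j; rewrite conj_permE tpermL hA // om.
apply/degsymP; split; rewrite ?det_conj_perm //.
  by apply/eqP; rewrite conj_perm_sym sA.
move=> i j mi; rewrite conj_permE hA //; case: tpermP => [_|e|_ _]; rewrite ?om //.
  by move: mi; rewrite e om ltnn.
exact: ltnW.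
Qed.

Lemma degsym_conj_perm n m c (s : {perm 'I_n}) (A : 'M[L]_n) :
  (forall i, (m <= s i)%N = (m <= i)%N) -> (conj_perm s A \in degsym n m c) = (A \in degsym n m c).
Proof.
move=> hs; apply/degsymP/degsymP => -[sA hA dA].
  split; last by rewrite -dA det_conj_perm.
    by apply/eqP; rewrite -(conj_perm_sym s) sA.
  move=> i j mi; rewrite -(permKV s i) -(permKV s j) -conj_permE; apply: hA.
  by rewrite -hs permKV.
split; last by rewrite det_conj_perm.
  by apply/eqP; rewrite conj_perm_sym sA.
by move=> i j mi; rewrite conj_permE hA // hs.
Qed.

Lemma det_mx2 (P : 'M[L]_2) : \det P = P 0 0 * P 1 1 - P 0 1 * P 1 0.
Proof.
rewrite (expand_det_row _ 0) !big_ord_recl big_ord0 addr0 /cofactor !det_mx11 !mxE /=.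
rewrite expr0 expr1 mul1r mulN1r mulrN.
by congr (P _ _ * P _ _ - P _ _ * P _ _); apply: val_inj.
Qed.

(** With the first row fixed, the second column remains to be chosen, its top entry being forced by
    symmetry; then [card_schur] applies to the leading 2 x 2 block. *)
Lemma card_row0_pivot2 n m c (w : 'cV[L]_(2 + n)) : (m <= n)%N ->
  nonunit (w 0 0) -> w (lshift n 1) 0 \is a GRing.unit ->
  (forall i : 'I_(2 + n), (2 + m <= i)%N -> nonunit (w i 0)) ->
  #|[set A in degsym (2 + n) (2 + m) c | (row 0 A)^T == w]| =
  (l ^ m.+1 * v ^ (n - m) * #|degsym n m c|)%N.
Proof.
move=> mn w0 w1 hw.
pose W := [set x : 'cV[L]_(1 + n.+1) | pred1 (w (lshift n 1) 0) (x 0 0) &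
      [forall i : 'I_(1 + n.+1), (1 + m.+1 <= i)%N ==> nonunit (x i 0)]].
pose g (x : 'cV[L]_(1 + n.+1)) : 'M[L]_(2 + n, 2) :=
  \matrix_(i, j) if j == 0 then w i 0 else x i 0.
have gE0 x i : g x i 0 = w i 0 by rewrite mxE.
have gE1 x i : g x i 1 = x i 0 by rewrite mxE.
have ord2 (j : 'I_2) : j = 0 \/ j = 1.
  by case: j => -[|[|//]] hj; [left|right]; apply: val_inj.
have injg : injective g.
  by move=> x y /matrixP e; apply/matrixP=> i j; rewrite ord1 -!gE1 e.
have cW : #|g @: W| = (l ^ m.+1 * v ^ (n - m))%N.
  by rewrite (card_imset _ injg) card_col_cond // card1 mul1n subSS.
rewrite -cW; apply: (card_fibers (f := fun A : 'M_(2 + n) => lsubmx A)).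
  move=> A /setIdP[/degsymP[sA hA _] /eqP ew].
  have Aw i : A i 0 = w i 0 by rewrite -ew -[in LHS]sA !mxE.
  apply/imsetP; exists (col (lshift n 1) A).
    rewrite inE /= -Aw !mxE -[in X in _ == X]sA mxE eqxx /=.
    by apply/forallP=> i; apply/implyP=> hi; rewrite mxE hA.
  by apply/matrixP=> i j; have [->|->] := ord2 j; rewrite ?gE0 ?gE1 !mxE ?lshift0 ?Aw.
move=> K /imsetP[x]; rewrite inE /= => /andP[/eqP x0 /forallP hx] ->.
rewrite -(card_schur nonunitD (k := 2) c (K := g x)).
- apply: eq_card => A; apply/setIdP/setIdP => [[/setIdP[DA _] e]|[DA e]]; split=> //.
  apply/setIdP; split=> //; have /degsymP[sA _ _] := DA.
  apply/eqP/matrixP=> i j; rewrite (ord1 j) -(gE0 x) -(eqP e) -[in LHS]sA !mxE.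
  by rewrite lshift0.
- apply/matrixP=> i j; rewrite !mxE.
  by have [->|->] := ord2 i; have [->|->] := ord2 j; rewrite //= lshift0 x0.
(* The block determinant is a nonunit minus the square of a unit, hence a unit. *)
- rewrite unitmxE det_mx2 !mxE /= !lshift0 x0.
  move: (x _ _) => t; apply: contraT => h;
  have := nonunitD (nonunitMl t w0) (etrans (nonunitN _) h).
  by rewrite opprB addrC subrK unitrM w1.
- move=> i j hi.
  have [->|->] := ord2 j.
    by rewrite gE0 hw.
  by rewrite gE1; have /implyP := hx i; apply.
Qed.

(** The difference counts the possible first rows: those with a nonunit diagonal entry, minus those
    made of nonunits only. The other factor comes from [card_row0_pivot2], after a transposition has
    brought a unit to position 1. *)
Lemma card_degsym_pivot2 n m c : (m <= n)%N ->
  #|[set A in degsym n.+2 m.+2 c |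
      nonunit (A 0 0) && ~~ [forall j, nonunit (A 0 j)]]| =
  ((v * (l ^ m.+1 * v ^ (n - m)) - v * v ^ n.+1) *
   (l ^ m.+1 * v ^ (n - m) * #|degsym n m c|))%N.
Proof.
move=> mn.
pose W1 := [set x : 'cV[L]_(1 + n.+1) | [pred y : L | nonunit y] (x 0 0) &
      [forall i : 'I_(1 + n.+1), (1 + m.+1 <= i)%N ==> nonunit (x i 0)]].
pose W2 := [set x : 'cV[L]_(1 + n.+1) | [pred y : L | nonunit y] (x 0 0) &
      [forall i : 'I_(1 + n.+1), (1 + 0 <= i)%N ==> nonunit (x i 0)]].
have W12 : W2 \subset W1.
  apply/subsetP=> x; rewrite !inE => /andP[-> /forallP h].
  by apply/forallP=> i; apply/implyP=> hi; have /implyP := h i; apply; apply: leq_trans hi.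
have <- : #|W1 :\: W2| = (v * (l ^ m.+1 * v ^ (n - m)) - v * v ^ n.+1)%N.
  by rewrite cardsD (setIidPr W12) !card_col_cond // subn0 subSS expn0 mul1n.
have W2E x : (x \in W2) = [forall i, nonunit (x i 0)].
  rewrite inE /=; apply/andP/forallP => [[h0 /forallP h] i|h]; last first.
    by split=> //; apply/forallP=> i; rewrite h implybT.
  have [->//|i0] := eqVneq i 0; have /implyP := h i; apply.
  by rewrite lt0n; apply: contraNneq i0 => e; apply/eqP/val_inj.
apply: (card_fibers (f := fun A : 'M[L]_n.+2 => (row 0 A)^T)).
  move=> A /setIdP[/degsymP[sA hA _] /andP[h0 h]]; rewrite inE W2E; apply/andP; split.
    by apply: contraNN h => /forallP h; apply/forallP=> j; have := h j; rewrite !mxE.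
  rewrite inE /= !mxE h0; apply/forallP=> i; apply/implyP=> hi.
  by rewrite !mxE -sA mxE hA.
move=> w /setDP[]; rewrite W2E inE /= => /andP[w0 /forallP hw].
rewrite negb_forall => /existsP[j]; rewrite negbK => uj.
(* The unit sits at an unrestricted index other than 0, so the transposition fixes 0 and preserves
   the set of restricted rows. *)
have jm : (j < m.+2)%N.
  by rewrite ltnNge; apply/negP=> mj; have := implyP (hw j) mj; rewrite uj.
have j0 : j != 0 by apply: contraNneq w0 => <-.
pose o : 'I_(2 + n) := lshift n 1; pose s := tperm o j.
have s0 : s 0 = 0 by rewrite /s tpermD // eq_sym.
have hs (i : 'I_(2 + n)) : (2 + m <= s i)%N = (2 + m <= i)%N.
  have oF : (2 + m <= o)%N = false by [].
  have jF : (2 + m <= j)%N = false by rewrite leqNgt jm.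
  by rewrite /s; case: tpermP => // ->; rewrite oF jF.
rewrite -(card_row0_pivot2 c (w := \col_i w (s i) 0) mn) ?mxE ?s0 //.
- apply: (card_conj_perm (s := s)) => A; rewrite [LHS]inE degsym_conj_perm //.
  rewrite !inE -!andbA; do 3!congr andb.
  apply/eqP/and3P=> [/matrixP e|[_ _ /eqP e]].
    have eA i : A 0 i = w i 0.
      by have := e (s^-1 i)%g 0; rewrite !mxE s0 permKV.
    split; first by rewrite eA.
      by rewrite negb_forall; apply/existsP; exists j; rewrite eA negbK.
    by apply/eqP/matrixP=> i k; rewrite !mxE eA ord1.
  by apply/matrixP=> i k; rewrite -e !mxE s0.
- by rewrite tpermL.
- by move=> i hi; rewrite mxE; have /implyP := hw (s i); apply; rewrite hs.
Qed.

Lemma card_degsym_recr n m c : (m <= n)%N ->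
  #|degsym n.+2 m.+2 c| =
  (u * (l ^ m.+1 * v ^ (n - m)) * #|degsym n.+1 m.+1 c| +
   (v * (l ^ m.+1 * v ^ (n - m)) - v * v ^ n.+1) *
     (l ^ m.+1 * v ^ (n - m) * #|degsym n m c|) + #|degsym n.+2 m.+1 c|)%N.
Proof.
move=> mn; rewrite -(card_degsym_row0 (n := n.+1) (m := m.+1)) // -card_degsym_pivot2 //.
rewrite -(card_degsym_pivot1 (n := n.+1) (m := m.+1)) //.
rewrite -(cardsID [set A : 'M[L]_n.+2 | A 0 0 \is a GRing.unit] (degsym n.+2 _ c)) -addnA.
congr addn; first by apply: eq_card => A; rewrite !inE.
rewrite -(cardsID [set A : 'M[L]_n.+2 | [forall j, nonunit (A 0 j)]]) addnC.
congr addn; apply: eq_card => A; rewrite !inE.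
  by rewrite andbA andbC; congr andb; exact: andbC.
by case: forallP => h; rewrite ?andbF // !andbT h.
Qed.

(** By symmetry the off-diagonal entries of the only free row lie in restricted rows, so no 2 x 2
    pivot can occur. *)
Lemma card_degsym_recr1 n c :
  #|degsym n.+1 1 c| = (u * v ^ n * #|degsym n 0 c| + #|degsym n.+1 0 c|)%N.
Proof.
have E := @card_degsym_pivot1 n 0 c (leq0n n); rewrite expn0 mul1n subn0 in E.
rewrite -(card_degsym_row0 (n := n) (m := 0)) // -E.
rewrite -(cardsID [set A : 'M[L]_n.+1 | A 0 0 \is a GRing.unit] (degsym n.+1 _ c)).
congr addn; apply: eq_card => A; first by rewrite !inE.
rewrite in_setD [RHS]inE andbC.
case: degsymP => //= -[sA hA _]; rewrite inE; apply/idP/forallP => [h0 j|]; last exact.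
have [->//|j0] := eqVneq j 0; rewrite -sA mxE hA // lt0n.
by apply: contraNneq j0 => e; apply/eqP/val_inj.
Qed.
End Recursion.

(** * Counts without a determinant condition, and division by [p] *)

Section Total.
Variable L : finComUnitRingType.
Local Notation nonunit x := (x \isn't a GRing.unit).
Local Notation l := #|L|.
Local Notation v := #|[pred x : L | nonunit x]|.
(** Multiplier 0 makes the determinant condition void, so the first column and the remaining block
    are independent. The truncated [m.-1] also covers [m = 0], where every row is restricted. *)
Lemma card_degsym_total_row n m : (m <= n.+1)%N ->
  #|degsym n.+1 m (0%R : L)| = (l ^ m * v ^ (n.+1 - m) * #|degsym n m.-1 (0%R : L)|)%N.
Proof.
move=> mn.
pose Q := [set w : 'cV[L]_(1 + n) | [forall i : 'I_(1 + n), (m <= i)%N ==> nonunit (w i 0)]].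
have <- : #|Q| = (l ^ m * v ^ (n.+1 - m))%N.
  rewrite -(@prod_card_cond L n.+1 m (fun i => [pred x : L | (m <= i)%N ==> nonunit x])) //.
  by rewrite -card_cV.
apply: (card_fibers (f := fun A : 'M_(1 + n) => lsubmx A)).
  move=> A /degsymP[_ hA _]; rewrite inE; apply/forallP=> i; apply/implyP=> hi.
  by rewrite mxE hA.
move=> w; rewrite inE => /forallP hw.
pose f (B : 'M[L]_n) : 'M_(1 + n) := block_mx (usubmx w) (dsubmx w)^T (dsubmx w) B.
have injf : injective f by move=> B B' /eq_block_mx[].
rewrite -(card_imset _ injf); apply: eq_card => A.
apply/setIdP/imsetP => [[/degsymP[sA hA _] /eqP ew]|[B /degsymP[sB hB _] ->]].
  exists (drsubmx A).
    apply/degsymP; split; rewrite ?mul0r //; first by rewrite trmx_drsub sA.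
    by move=> i j hi; rewrite !mxE hA //= ?add1n; lia.
  rewrite /f -[A in LHS]submxK -ew; congr block_mx; apply/matrixP=> i j; rewrite !mxE //.
  by rewrite -[in LHS]sA mxE.
split; last by rewrite /f block_mxEh row_mxKl vsubmxK.
apply/degsymP; split; rewrite ?mul0r //.
  rewrite /f tr_block_mx trmxK sB; congr block_mx.
  by apply/matrixP=> i j; rewrite !mxE !ord1.
move=> i j; rewrite /f -(splitK i) -(splitK j).
case: (split i) => i'; case: (split j) => j' /=.
- by move=> h; rewrite block_mxEul mxE (ord1 j'); apply: implyP (hw (lshift n i')) _.
- rewrite block_mxEur !mxE (ord1 i') => h; apply: implyP (hw (rshift 1 j')) _.
  exact: leq_trans h _.
- by move=> h; rewrite block_mxEdl mxE (ord1 j'); apply: implyP (hw (rshift 1 i')) _.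
- by rewrite block_mxEdr add1n => h; apply: hB; lia.
Qed.

(** Freeing row [m] affects only its entries in columns at most [m]: the later ones also lie in
    restricted rows by symmetry. *)
Lemma card_degsym_total_step n m : (m < n)%N ->
  (#|degsym n m (0%R : L)| * l ^ m.+1 = #|degsym n m.+1 (0%R : L)| * v ^ m.+1)%N.
Proof.
elim: n m => [//|n IH] [|m] mn; rewrite !card_degsym_total_row //=; last exact: ltnW.
  rewrite subn0 subSS subn0 !expn1 expn0 expnS; lia.
have -> : (n.+1 - m.+1 = (n.+1 - m.+2).+1)%N by lia.
rewrite (expnS v (n.+1 - m.+2)) (expnS v m.+1).
transitivity (l ^ m.+2 * v ^ (n.+1 - m.+2) * v * (#|degsym n m (0%R : L)| * l ^ m.+1))%N.
  by rewrite expnS; ring.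
by rewrite IH //; ring.
Qed.

Lemma card_degsym_total_gt0 n m : (0 < #|degsym n m (0%R : L)|)%N.
Proof.
apply/card_gt0P; exists 0; apply/degsymP; split; rewrite ?mul0r ?trmx0 //.
by move=> i j _; rewrite mxE unitr0.
Qed.

(** Multiplication by [p] maps unrestricted symmetric matrices onto those with nonunit entries, and
    its fibres are cosets of the symmetric matrices killed by [p]. Using it for the multipliers [c]
    and 0 eliminates the coset size [K]. *)
Lemma card_degsym_scale n c (p : L) :
  (forall x : L, nonunit x <-> exists y, x = p * y) ->
  (#|degsym n 0 c| * #|degsym n n (0%R : L)| =
   #|degsym n n (c * p ^+ n)%R| * #|degsym n 0 (0%R : L)|)%N.
Proof.
move=> hp.
pose K := #|[set B : 'M[L]_n | (B^T == B) && (p *: B == 0)]|.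
have E d : #|degsym n n (d * p ^+ n)%R| = (#|degsym n 0 d| * K)%N.
  apply: (card_fibers (f := fun B : 'M[L]_n => p *: B)) => A /degsymP[sA hA dA].
    apply/degsymP; split; first by rewrite linearZ /= sA.
      by move=> i j _; apply/hp; exists (A i j); rewrite mxE.
    by rewrite detZ mulrA.
  (* A single function [g] divides all nonunits by [p], so the entrywise lift stays symmetric. *)
  have /fin_all_exists[g hg] : forall x : L, exists y, nonunit x -> x = p * y.
    by move=> x; case: (boolP (nonunit x)) => [/hp[y ->]|]; [exists y|exists 0].
  pose B0 := map_mx g A.
  have sB0 : B0^T = B0 by rewrite /B0 map_trmx sA.
  have eB0 : p *: B0 = A by apply/matrixP=> i j; rewrite !mxE -hg // hA.
  rewrite /K -[RHS](card_imset _ (addrI B0)); apply: eq_card => B.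
  apply/setIdP/imsetP => [[/degsymP[sB _ _] /eqP eB]|[N]].
    exists (B - B0); last by rewrite addrC subrK.
    by rewrite inE linearB /= sB sB0 eqxx scalerBr eB eB0 subrr /=.
  rewrite inE => /andP[/eqP sN /eqP eN] ->; rewrite scalerDr eB0 eN addr0; split=> //.
  apply/degsymP; split; first by rewrite linearD /= sB0 sN.
    by move=> i j; rewrite leqNgt ltn_ord.
  by rewrite -mulrA -detZ scalerDr eB0 eN addr0.
by have := E 0; rewrite mul0r E => ->; rewrite mulnAC mulnA.
Qed.
End Total.

(** * From counts to probabilities *)

Section Probability.
Variables (R : numFieldType) (L : finComUnitRingType).
Local Notation nonunit x := (x \isn't a GRing.unit).
Hypothesis nonunitD : forall x y : L, nonunit x -> nonunit y -> nonunit (x + y).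
Local Notation l := #|L|.
Local Notation v := #|[pred x : L | nonunit x]|.
Local Notation q := (v%:R / l%:R : R).
Implicit Types (c : L).

Definition probdeg n m c : R := #|degsym n m c|%:R / #|degsym n m (0%R : L)|%:R.

Lemma card_ring_neq0 : l%:R != 0 :> R.
Proof. by rewrite pnatr_eq0 -lt0n; apply/card_gt0P; exists 0. Qed.

Lemma card_nonunit_neq0 : v%:R != 0 :> R.
Proof. by rewrite pnatr_eq0 -lt0n; apply/card_gt0P; exists 0; rewrite inE unitr0. Qed.

Lemma card_unitsE : #|[pred x : L | x \is a GRing.unit]|%:R = l%:R - v%:R :> R.
Proof. by rewrite -card_units natrD addrK. Qed.

Lemma total_neq0 n m : #|degsym n m (0%R : L)|%:R != 0 :> R.
Proof. by rewrite pnatr_eq0 -lt0n card_degsym_total_gt0. Qed.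

Lemma probdeg0 n m : probdeg n m 0 = 1.
Proof. by rewrite /probdeg divff // total_neq0. Qed.

Lemma probdeg00 c : probdeg 0 0 c = (c == 0)%:R.
Proof.
have [->|c0] := eqVneq c 0; first by rewrite probdeg0.
rewrite /probdeg (_ : #|degsym 0 0 c| = 0%N) ?mul0r //.
apply: eq_card0 => A; apply/degsymP => -[_ _ /eqP].
by rewrite det_mx00 mulr1 (negbTE c0).
Qed.

Lemma probdeg_recr1 n c : probdeg n.+1 1 c = (1 - q) * probdeg n 0 c + q * probdeg n.+1 0 c.
Proof.
rewrite /probdeg card_degsym_recr1 //.
have := @card_degsym_total_step L n.+1 0 isT; rewrite !expn1 => /(congr1 (fun k => k%:R : R)).
have := @card_degsym_total_row L n 1 isT.
rewrite expn1 subSS subn0 => /(congr1 (fun k => k%:R : R)) /=.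
have := total_neq0 n 0; have := total_neq0 n.+1 0; have := total_neq0 n.+1 1.
rewrite !natrD !natrM !natrX card_unitsE.
have : v%:R ^+ n != 0 :> R by rewrite expf_neq0 ?card_nonunit_neq0.
have := card_ring_neq0; have := card_nonunit_neq0.
move: (v%:R ^+ n : R) (v%:R : R) (l%:R : R) => w b a b0 a0 w0.
move: (#|degsym n.+1 1 (0%R : L)|%:R : R) (#|degsym n.+1 0 (0%R : L)|%:R : R).
move: (#|degsym n 0 (0%R : L)|%:R : R) => T3 T1 T2 T10 T20 T30 e1 e2.
have -> : T2 = T1 * b / a by rewrite -e2 mulfK.
by rewrite e1; field; rewrite ?a0 ?b0 ?w0 ?T30.
Qed.

(** The coefficients are the chances of three cases for the first row: unit diagonal entry; nonunit
    diagonal entry with a unit among the other [m.+1] free entries; all [m.+2] free entries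
    nonunits. *)
Lemma probdeg_recr n m c : (m <= n)%N ->
  probdeg n.+2 m.+2 c = (1 - q) * probdeg n.+1 m.+1 c +
    q * (1 - q ^+ m.+1) * probdeg n m c + q ^+ m.+2 * probdeg n.+2 m.+1 c.
Proof.
move=> mn; rewrite /probdeg card_degsym_recr //.
have /(congr1 (fun k => k%:R : R)) := @card_degsym_total_step L n.+2 m.+1 mn.
have /(congr1 (fun k => k%:R : R)) := @card_degsym_total_row L n.+1 m.+2 mn.
have /(congr1 (fun k => k%:R : R)) := @card_degsym_total_row L n m.+1 mn.
rewrite !subSS /= !natrD !natrM !natrX.
have := total_neq0 n m; have := total_neq0 n.+1 m.+1; have := total_neq0 n.+2 m.+1.
have -> : (v * v ^ n.+1 = v * (v ^ m.+1 * v ^ (n - m)))%N.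
  by rewrite -expnD; congr (_ * _ ^ _)%N; lia.
rewrite natrB; last first.
  rewrite !leq_mul2l !leq_mul2r leq_exp2r // max_card !orbT //.
rewrite !natrM !natrX card_unitsE expr_div_n !(exprS _ m.+1) expr_div_n.
have := card_ring_neq0; have := card_nonunit_neq0.
move: (v%:R : R) (l%:R : R) => b a b0 a0.
move: (#|degsym n.+2 m.+2 (0%R : L)|%:R : R) (#|degsym n.+2 m.+1 (0%R : L)|%:R : R).
move: (#|degsym n.+1 m.+1 (0%R : L)|%:R : R) (#|degsym n m (0%R : L)|%:R : R).
move=> T1 T2 T T3 T30 T10 T20 e1 e e3.
have w0 := expf_neq0 (n - m) b0; have x0 := expf_neq0 m.+1 a0; have y0 := expf_neq0 m.+1 b0.
(* The powers become independent variables, so that [field] faces a plain rational identity. *)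
have aux (w x y D1 D2 D3 : R) : w != 0 -> x != 0 -> y != 0 -> T1 = x * w * T2 ->
    T = a * x * w * T1 -> T3 * (a * x) = T * (b * y) ->
    ((a - b) * (x * w) * D1 + (b * (x * w) - b * (y * w)) * (x * w * D2) + D3) / T =
    (1 - b / a) * (D1 / T1) + b / a * (1 - y / x) * (D2 / T2) + b / a * (y / x) * (D3 / T3).
  move=> {}w0 {}x0 {}y0 {}e1 {}e {}e3.
  have -> : T3 = T * (b * y) / (a * x) by rewrite -e3 mulfK // mulf_neq0.
  by rewrite e e1; field; rewrite ?a0 ?b0 ?w0 ?x0 ?y0 ?T20.
exact: aux.
Qed.

Lemma probdeg_scale n c (p : L) :
  (forall x : L, nonunit x <-> exists y, x = p * y) ->
  probdeg n 0 c = probdeg n n (c * p ^+ n).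
Proof.
move=> hp; rewrite /probdeg; apply/eqP.
rewrite eqr_div ?total_neq0 // -!natrM eqr_nat; apply/eqP; exact: card_degsym_scale.
Qed.
End Probability.

(** * The convolution identity *)

Section QSeries.
Variables (R : fieldType) (q : R).
Hypothesis q_free : forall j, 1 - q ^+ j.+1 != 0.

Lemma Pi0 (x : R) : Pi 0 x = 1.
Proof. by rewrite /Pi big_nil. Qed.

Lemma PiS n (x : R) : Pi n.+1 x = Pi n x * (1 - x ^+ n.+1).
Proof. by rewrite /Pi big_nat_recr. Qed.

Lemma Pi_neq0 n : Pi n q != 0.
Proof. by elim: n => [|n IH]; rewrite ?Pi0 ?oner_eq0 // PiS mulf_neq0. Qed.

Lemma q2_free j : 1 - (q ^+ 2) ^+ j.+1 != 0.
Proof. by rewrite -exprM mulnS; exact: (q_free (1 + 2 * j)). Qed.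

Lemma Pi2_neq0 n : Pi n (q ^+ 2) != 0.
Proof. by elim: n => [|n IH]; rewrite ?Pi0 ?oner_eq0 // PiS mulf_neq0 // q2_free. Qed.

(* Extended by zero, so that the recurrence below has no boundary terms. *)
Definition inv_Pi_half d : R := if d is d'.+2 then (Pi d'./2 (q ^+ 2))^-1 else 0.

Lemma inv_Pi_half_rec d :
  (1 - q ^+ d) * inv_Pi_half d.+2 = (1 - q) * inv_Pi_half d.+1 + q * inv_Pi_half d.
Proof.
case: d => [|[|d]]; first by rewrite /= expr0 subrr !mul0r !mulr0 addr0.
  by rewrite /= expr1 mulr0 addr0.
rewrite -(odd_double_half d); move: (d./2) => k; have Pk := Pi2_neq0 k.
have P2k : 1 - q ^+ k.*2.+2 != 0 by exact: q_free.
case: (odd d) => /=; rewrite ?uphalf_double ?doubleK ?add0n ?add1n /= ?uphalf_double ?doubleK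
  PiS -exprM mul2n doubleS.
  rewrite [q ^+ k.*2.+3]exprS.
  by move: (Pi k _) (q ^+ k.*2.+2) Pk P2k => P X P0 X0; field; rewrite P0.
by move: (Pi k _) (q ^+ k.*2.+2) Pk P2k => P X P0 X0; field; rewrite P0.
Qed.

(* The probability that a random symmetric n x n matrix over the residue field of order 1/q
   has corank c; it vanishes for c > n. *)
Definition corank_prob n c : R :=
  q ^+ 'C(c.+1, 2) * Pi n q / Pi c q * inv_Pi_half (n.+2 - c).

Lemma corank_prob_gt n c : (n < c)%N -> corank_prob n c = 0.
Proof.
rewrite /corank_prob => nc; have : (n.+2 - c <= 1)%N by lia.
by case: (n.+2 - c)%N => [|[|//]] _; rewrite mulr0.
Qed.

Lemma corank_probE d c : corank_prob (d + c) c =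
  q ^+ 'C(c.+1, 2) * Pi (d + c) q / (Pi c q * Pi d./2 (q ^+ 2)).
Proof. by rewrite /corank_prob -!addSn addnK invfM !mulrA. Qed.

(** This is row peeling over the residue field: the first row provides a 1 x 1 pivot, a 2 x 2 pivot,
    or vanishes and raises the corank by one. *)
Lemma corank_prob_recr m c :
  corank_prob m.+2 c = (1 - q) * corank_prob m.+1 c +
    q * (1 - q ^+ m.+1) * corank_prob m c +
    q ^+ m.+2 * (if c is c'.+1 then corank_prob m.+1 c' else 0).
Proof.
have hE := inv_Pi_half_rec m.+2.
have h1 := q_free m; have h2 := q_free m.+1.
case: c => [|c]; rewrite /corank_prob !PiS.
  rewrite !subn0 Pi0 bin_small // expr0.
  move: (inv_Pi_half m.+4) (inv_Pi_half m.+3) (inv_Pi_half m.+2) hE => a b c0 E.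
  move: (Pi m q) => P.
  rewrite !divr1 !mul1r mulr0 addr0.
  by rewrite -[LHS]mulrA E; ring.
have [cm|mc] := leqP c.+1 m.+2; last first.
  have e k : (k <= 1)%N -> inv_Pi_half k = 0 by case: k => [|[]].
  by rewrite !e; [rewrite !mulr0 !addr0| lia..].
pose d := (m.+2 - c.+1)%N.
have -> : (m.+4 - c.+1 = d.+2)%N by rewrite /d; lia.
have -> : (m.+3 - c.+1 = d.+1)%N by rewrite /d; lia.
have -> : (m.+3 - c = d.+2)%N by rewrite /d; lia.
rewrite -/d (binS c.+1) bin1 exprD.
have -> : q ^+ m.+2 = q ^+ d * q ^+ c.+1 by rewrite -exprD; congr (_ ^+ _); rewrite /d; lia.
have := inv_Pi_half_rec d.
move: (inv_Pi_half d.+2) (inv_Pi_half d.+1) (inv_Pi_half d) => a b b0 E.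
have := Pi_neq0 c; have := q_free c.
move: (Pi m q) (Pi c q) (q ^+ 'C(c.+1, 2)) (q ^+ c.+1) (q ^+ m.+1) (q ^+ d) E
  => P Pc t X Y Z E X0 P0.
apply/eqP; rewrite -subr_eq0; apply/eqP.
(* The difference of the two sides is a multiple of the recurrence [inv_Pi_half_rec]. *)
transitivity (t * X * P * (1 - Y) / (Pc * (1 - X)) * ((1 - Z) * a - ((1 - q) * b + q * b0))).
  by field; rewrite X0 P0.
by rewrite E subrr mulr0.
Qed.

Section Convolution.
Variables (M : nat) (F : nat -> nat -> nat -> R).
Hypothesis F0 : forall n j, (j <= M)%N -> F n 0 j = F n n (j - n).
Hypothesis F1 : forall n j, (j <= M)%N -> F n.+1 1 j = (1 - q) * F n 0 j + q * F n.+1 0 j.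
Hypothesis FS : forall n m j, (j <= M)%N -> (m <= n)%N ->
  F n.+2 m.+2 j = (1 - q) * F n.+1 m.+1 j +
    q * (1 - q ^+ m.+1) * F n m j + q ^+ m.+2 * F n.+2 m.+1 j.

(** Here [r] rows are restricted and [c] is the corank of the free part, so [r + c] rows are left to
    be divided by [p]. Both sides satisfy the same recurrence in [m], where [r] grows each time a
    free row becomes restricted. *)
Lemma convolution m r j : (j <= M)%N ->
  F (r + m) m j =
  \sum_(c < m.+1) corank_prob m c * F (r + c) (r + c) (j - (r + c)).
Proof.
move=> jM; pose g k := F k k (j - k).
pose S m r := \sum_(c < m.+1) corank_prob m c * g (r + c)%N.
have SS k s : S k.+2 s = (1 - q) * S k.+1 s + q * (1 - q ^+ k.+1) * S k s + q ^+ k.+2 * S k.+1 s.+1.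
  have -> : S k.+1 s = \sum_(c < k.+3) corank_prob k.+1 c * g (s + c)%N.
    by rewrite [RHS]big_ord_recr /= corank_prob_gt // mul0r addr0.
  have -> : S k s = \sum_(c < k.+3) corank_prob k c * g (s + c)%N.
    by rewrite [RHS]big_ord_recr [X in _ = X + _]big_ord_recr /= !corank_prob_gt // !mul0r !addr0.
  have -> : q ^+ k.+2 * S k.+1 s.+1 = \sum_(c < k.+3)
      q ^+ k.+2 * (if nat_of_ord c is c'.+1 then corank_prob k.+1 c' else 0) * g (s + c)%N.
    rewrite [RHS]big_ord_recl /= mulr0 mul0r add0r mulr_sumr.
    by apply: eq_bigr => i _; rewrite /= -mulrA addnS.
  rewrite !mulr_sumr -!big_split; apply: eq_bigr => c _ /=.
  by rewrite corank_prob_recr !mulrDl !mulrA.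
rewrite -/(S m r).
(* The recurrence has order two in [m], so two consecutive values are carried along, for all [r]. *)
suff [] : F (r + m)%N m j = S m r /\ F (r + m.+1)%N m.+1 j = S m.+1 r by [].
elim: m r => [|m IH] r.
  have S0 s : F s 0%N j = S 0%N s.
    rewrite /S big_ord1 addn0 F0 // /corank_prob /= !Pi0 bin_small //.
    by rewrite expr0 !mul1r divr1 invr1 !mul1r.
  rewrite addn0 S0 addn1 F1 // !S0; split=> //.
  rewrite /S !big_ord_recl !big_ord0 /= !addr0 addn0 addn1.
  rewrite /corank_prob /= !PiS !Pi0 bin_small // binn !expr1 expr0 !divr1 !mul1r.
  by rewrite mulfK ?addn0 //; have := q_free 0; rewrite expr1.
split; first by have [_] := IH r.
rewrite !addnS FS ?leq_addl // SS.
have [e1 e2] := IH r; have [_ e3] := IH r.+1.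
by rewrite e1 -!addnS e2 -e3 !addnS addSn.
Qed.
End Convolution.
End QSeries.

(** * Two recurrences for odd sizes *)

Lemma big_ord_double (V : nmodType) (a : nat -> V) K :
  \sum_(c < K.*2) a c = \sum_(k < K) (a k.*2 + a k.*2.+1).
Proof.
by elim: K => [|K IH]; rewrite ?big_ord0 // doubleS !big_ord_recr /= IH addrA.
Qed.

Section Recurrences.
Variables (R : fieldType) (q : R) (M : nat) (x : nat -> nat -> R).
Hypothesis q_free : forall j, 1 - q ^+ j.+1 != 0.
Hypothesis x0 : forall n, x n 0%N = 1.
Hypothesis xE : forall n j, (j <= M)%N ->
  x n j = \sum_(c < n.+1) corank_prob q n c * x c (j - c)%N.
Local Notation P := (corank_prob q).

(** With [N = k + e], this and the next two relations link the coranks [2k] and [2k+1] in sizes [2N]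
    and [2N+1]; together they make the sums in [odd_step] cancel. *)
Lemma corank_prob_even k e :
  P (k + e).*2.+1 k.*2 = (1 - q ^+ (k + e).*2.+1) * P (k + e).*2 k.*2.
Proof.
have -> : ((k + e).*2.+1 = e.*2.+1 + k.*2)%N by lia.
have -> : ((k + e).*2 = e.*2 + k.*2)%N by lia.
rewrite !corank_probE addSn PiS /= uphalf_double doubleK.
by have := Pi_neq0 q_free k.*2; have := Pi2_neq0 q_free e => a b; field; rewrite a b.
Qed.

Lemma corank_prob_odd k e :
  (1 - q ^+ e.*2) * P (k + e).*2.+1 k.*2.+1 =
  (1 - q ^+ (k + e).*2.+1) * P (k + e).*2 k.*2.+1.
Proof.
case: e => [|e]; first by rewrite expr0 subrr mul0r corank_prob_gt ?mulr0 // addn0.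
have -> : ((k + e.+1).*2.+1 = e.+1.*2 + k.*2.+1)%N by lia.
have -> : ((k + e.+1).*2 = e.*2.+1 + k.*2.+1)%N by lia.
rewrite !corank_probE doubleS !addSn (PiS (_.+1)) /= uphalf_double doubleK (PiS e).
rewrite -exprM mul2n doubleS.
have := Pi_neq0 q_free k.*2.+1; have := Pi2_neq0 q_free e; have := q_free e.*2.+1 => a b c.
by field; rewrite a b c.
Qed.

Lemma corank_prob_succ k e :
  (1 - q ^+ k.*2.+1) * P (k + e).*2.+1 k.*2.+1 = q ^+ k.*2.+1 * P (k + e).*2.+1 k.*2.
Proof.
have E1 : ((k + e).*2.+1 = e.*2.+1 + k.*2)%N by lia.
have E2 : ((k + e).*2.+1 = e.*2 + k.*2.+1)%N by lia.
rewrite {1}E2 E1 !corank_probE -E1 -E2 (PiS k.*2) /= uphalf_double doubleK binS bin1 exprD.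
have := Pi_neq0 q_free k.*2; have := Pi2_neq0 q_free e; have := q_free k.*2 => a b c.
by field; rewrite a b c.
Qed.

(** All three values are expanded by the convolution identity and their terms grouped in pairs [2k],
    [2k+1]. The induction hypothesis in size [2k+1], at a smaller [j], makes each pair cancel. *)
Lemma odd_step N j : (j <= M)%N ->
  x N.*2.+1 j = (1 - q ^+ N.*2.+1) * x N.*2 j + q ^+ N.*2.+1 * x N.*2.+1 j.-1.
Proof.
elim/ltn_ind: j N => -[_ N _|j IH N jM]; first by rewrite !x0; ring.
have jM' : (j <= M)%N by exact: ltnW.
(* A zero term at [c = 2N+1] lets the even size split into pairs too. *)
have -> : x N.*2 j.+1 = \sum_(c < N.*2.+2) P N.*2 c * x c (j.+1 - c)%N.
  by rewrite big_ord_recr /= corank_prob_gt // mul0r addr0 -xE.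
rewrite [in LHS]xE // [x N.*2.+1 j.+1.-1]xE // -doubleS.
rewrite (big_ord_double (fun c => P N.*2.+1 c * x c (j.+1 - c)%N)).
rewrite (big_ord_double (fun c => P N.*2 c * x c (j.+1 - c)%N)).
rewrite (big_ord_double (fun c => P N.*2.+1 c * x c (j.+1.-1 - c)%N)).
rewrite !mulr_sumr -big_split.
apply: eq_bigr => k _ /=; have kN : (k <= N)%N by rewrite -ltnS.
have := corank_prob_even k (N - k); have := corank_prob_odd k (N - k).
have := corank_prob_succ k (N - k); rewrite subnKC //.
have := IH (j.+1 - k.*2.+1)%N _ k.
have -> : (j.+1 - k.*2.+1 = j - k.*2)%N by lia.
have -> : (j - k.*2).-1 = (j - k.*2.+1)%N by lia.
move=> -> //; [| lia | lia].
have -> : q ^+ N.*2.+1 = q ^+ (N - k).*2 * q ^+ k.*2.+1 by rewrite -exprD; congr (_ ^+ _); lia.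
move: (q ^+ _.*2) (q ^+ k.*2.+1) (P _ _) (P _ _) (P N.*2 k.*2) (P N.*2 k.*2.+1).
move=> E K A B C D e1 e2 e3.
move: (x _ _) (x _ _) (x _ _) => Z Y X; apply/eqP; rewrite -subr_eq0; apply/eqP.
transitivity ((A - (1 - E * K) * C) * X + ((1 - E) * B - (1 - E * K) * D) * ((1 - K) * Y + K * Z)
  + E * ((1 - K) * B - K * A) * Y); first by ring.
by rewrite e1 e2 -e3 !subrr mulr0 !mul0r !addr0.
Qed.

(** By [corank_prob_succ] each pair of terms is a multiple of the right-hand side of [odd_step], so
    the even sizes disappear. *)
Lemma odd_convolution N j : (j <= M)%N ->
  x N.*2.+1 j = \sum_(k < N.+1) P N.*2.+1 k.*2 / (1 - q ^+ k.*2.+1) * x k.*2.+1 (j - k.*2)%N.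
Proof.
move=> jM; rewrite xE // -doubleS.
rewrite (big_ord_double (fun c => P N.*2.+1 c * x c (j - c)%N)); apply: eq_bigr => k _ /=.
have kN : (k <= N)%N by rewrite -ltnS.
have := corank_prob_succ k (N - k); rewrite subnKC //.
rewrite (@odd_step k (j - k.*2)%N); last lia.
have -> : (j - k.*2).-1 = (j - k.*2.+1)%N by lia.
move=> e; have h := q_free k.*2.
have -> : P N.*2.+1 k.*2.+1 = q ^+ k.*2.+1 * P N.*2.+1 k.*2 / (1 - q ^+ k.*2.+1).
  by rewrite -e mulrC mulKf.
by field; rewrite h.
Qed.

Definition odd_coef N k : R := P N.*2.+1 k.*2 / (1 - q ^+ k.*2.+1).
Local Notation B := odd_coef.

Lemma odd_coefE k e : B (k + e) k =
  q ^+ 'C(k.*2.+1, 2) * Pi (k + e).*2.+1 q / (Pi k.*2.+1 q * Pi e (q ^+ 2)).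
Proof.
rewrite /odd_coef; have -> : ((k + e).*2.+1 = e.*2.+1 + k.*2)%N by lia.
rewrite corank_probE (PiS k.*2) /= uphalf_double.
have := Pi_neq0 q_free k.*2; have := Pi2_neq0 q_free e; have := q_free k.*2 => a b c.
by field; rewrite a b c.
Qed.

Lemma odd_coef_pred k e : (0 < k + e)%N ->
  (1 - q ^+ (k + e).*2.+1) * (if e is e'.+1 then B (k + e') k else 0) =
  B (k + e) k * ((1 - q ^+ e.*2) / (1 - q ^+ (k + e).*2)).
Proof.
case: e => [|e] _; first by rewrite expr0 subrr mul0r !mulr0.
rewrite !odd_coefE addnS doubleS !PiS -exprM mul2n doubleS.
have := Pi_neq0 q_free k.*2; have := Pi2_neq0 q_free e; have := q_free k.*2 => a b c.
have d := q_free e.*2.+1; have f := q_free (k + e).*2.+1.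
by field; rewrite a b c d f.
Qed.

Lemma odd_coef_succ k e :
  B (k.+1 + e) k.+1 * ((1 - q ^+ k.*2.+2) * (1 - q ^+ k.*2.+3)) =
  B (k + e.+1) k * (q ^+ k.*2.*2.+3 * (1 - q ^+ e.+1.*2)).
Proof.
rewrite !odd_coefE addSnnS; move: (Pi (k + e.+1).*2.+1 q) => P0.
have -> : 'C(k.+1.*2.+1, 2) = (k.*2.*2.+3 + 'C(k.*2.+1, 2))%N.
  rewrite doubleS (binS k.*2.+2) (binS k.*2.+1) !bin1; lia.
rewrite exprD doubleS !PiS -exprM mul2n doubleS.
have := Pi_neq0 q_free k.*2; have := Pi2_neq0 q_free e; have := q_free k.*2 => a b c.
have d := q_free k.*2.+1; have f := q_free k.*2.+2; have g := q_free e.*2.+1.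
by field; rewrite a b c d f g.
Qed.

(** By [odd_convolution] the difference of the two sides is a sum of terms [t k], which telescopes
    with the help of the induction hypothesis at smaller [j]. *)
Lemma odd_two_step N j : (j <= M)%N ->
  x N.+1.*2.+1 j = q ^+ N.+1.*2.+1 * x N.+1.*2.+1 (j - 2)%N
    + (1 - q ^+ N.+1.*2.+1) * x N.*2.+1 j.
Proof.
elim/ltn_ind: j N => -[_ N _|j IH N jM]; first by rewrite !x0; ring.
apply/eqP; rewrite -subr_eq0; apply/eqP.
pose y k i := x k.*2.+1 i.
rewrite -/(y N.+1 _) -/(y N.+1 _) -/(y N _).
(* The partial sum up to [K] will be [- g K] times a single value of [y K]; the factor
   [1 - q ^+ (N.+1 - K).*2] makes the full sum vanish. *)
pose g k := q ^+ N.+1.*2.+1 * B N.+1 k * q ^+ k.*2 * (1 - q ^+ (N.+1 - k).*2) / (1 - q ^+ N.+1.*2).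
pose t k := B N.+1 k * ((1 - (1 - q ^+ (N.+1 - k).*2) / (1 - q ^+ N.+1.*2)) * y k (j.+1 - k.*2)%N
  - q ^+ N.+1.*2.+1 * y k (j.+1 - k.*2 - 2)%N).
have -> : y N.+1 j.+1 - (q ^+ N.+1.*2.+1 * y N.+1 (j.+1 - 2)%N + (1 - q ^+ N.+1.*2.+1) * y N j.+1)
   = \sum_(k < N.+2) t k.
  have -> : (1 - q ^+ N.+1.*2.+1) * y N j.+1 = \sum_(k < N.+2)
      B N.+1 k * ((1 - q ^+ (N.+1 - k).*2) / (1 - q ^+ N.+1.*2)) * y k (j.+1 - k.*2)%N.
    rewrite big_ord_recr /= subnn expr0 subrr mul0r mulr0 mul0r addr0 /y.
    rewrite odd_convolution // mulr_sumr.
    apply: eq_bigr => k _; rewrite mulrA; congr (_ * _).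
    have kN : (k <= N)%N by rewrite -ltnS.
    have := @odd_coef_pred k (N - k).+1; rewrite addnS subnKC // -subSn // => <- //.
  rewrite {1 2}/y !odd_convolution //; last lia.
  rewrite mulr_sumr -big_split -sumrB; apply: eq_bigr => k _ /=.
  rewrite -/(B _ _) /t /y [(j.+1 - 2 - _)%N]subnAC; ring.
have psum K : (K <= N.+1)%N -> \sum_(k < K.+1) t k = - g K * y K (j.+1 - K.*2 - 2)%N.
  elim: K => [_|K IHK KN].
    rewrite big_ord1 /t /g !subn0 expr0 divff ?subrr ?mul0r ?sub0r; last by exact: q_free.
    have := q_free N.*2.+1; rewrite -doubleS => h; field; exact: h.
  rewrite big_ord_recr /= IHK; last exact: ltnW.
  have -> : (j.+1 - K.*2 - 2 = j.+1 - K.+1.*2)%N by lia.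
  rewrite /t /g; set J := (j.+1 - K.+1.*2)%N.
  have -> : y K.+1 J = q ^+ K.+1.*2.+1 * y K.+1 (J - 2)%N + (1 - q ^+ K.+1.*2.+1) * y K J.
    by apply: IH; rewrite /J; lia.
  have := odd_coef_succ K (N - K); have h := q_free N.*2.+1.
  have -> : (K.+1 + (N - K) = N.+1)%N by lia.
  have -> : (K + (N - K).+1 = N.+1)%N by lia.
  have -> : ((N.+1 - K) = (N - K).+1)%N by lia.
  have -> : ((N.+1 - K.+1) = (N - K))%N by lia.
  move: (y _ _) (y _ _) (B _ _) (B _ _) => Y Y' b b'.
  pose a := q ^+ K.*2; pose w := q ^+ (N - K).*2.
  rewrite !doubleS.
  have -> : q ^+ K.*2.+2 = q ^+ 2 * a by rewrite -exprD.
  have -> : q ^+ K.*2.+3 = q ^+ 3 * a by rewrite -exprD.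
  have -> : q ^+ K.*2.*2.+3 = q ^+ 3 * a * a by rewrite -!exprD; congr (_ ^+ _); lia.
  have -> : q ^+ (N - K).*2.+2 = q ^+ 2 * w by rewrite -exprD.
  have eN : q ^+ N.*2.+2 = q ^+ 2 * a * w by rewrite -!exprD; congr (_ ^+ _); lia.
  rewrite (exprS _ N.*2.+2) eN; rewrite eN in h; rewrite -/a -/w.
  move=> e; apply/eqP; rewrite -subr_eq0; apply/eqP.
  clear eN; clearbody a w.
  (* The last factor is the relation [odd_coef_succ] between adjacent coefficients. *)
  transitivity (w / (1 - q ^+ 2 * a * w) * Y' *
    (b' * ((1 - q ^+ 2 * a) * (1 - q ^+ 3 * a)) - b * (q ^+ 3 * a * a * (1 - q ^+ 2 * w)))).
    by field; rewrite h.
  by rewrite e subrr mulr0.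
by rewrite psum // /g subnn expr0 subrr mulr0 mul0r oppr0 mul0r.
Qed.
End Recurrences.

(** * Closed form *)

Section Tails.
Variables (R : fieldType) (q : R).
Hypothesis q_free : forall j, 1 - q ^+ j.+1 != 0.
Local Notation Q := (q ^+ 2).

(** The q-Pochhammer symbol [(z; q^2)_N]. *)
Definition qpoch (z : R) N := \prod_(0 <= i < N) (1 - z * Q ^+ i).

Lemma qpochS z N : qpoch z N.+1 = qpoch z N * (1 - z * Q ^+ N).
Proof. by rewrite /qpoch big_nat_recr. Qed.

Lemma qpoch0 z : qpoch z 0 = 1.
Proof. by rewrite /qpoch big_nil. Qed.

Lemma qpoch_shift N : (1 - q) * qpoch (q ^+ 3) N = qpoch q N * (1 - q ^+ N.*2.+1).
Proof.
elim: N => [|N IH]; first by rewrite !qpoch0 mulr1 mul1r.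
rewrite !qpochS mulrA IH -exprM mul2n -exprD -exprS.
by rewrite doubleS.
Qed.

Lemma Pi_double N : Pi N.*2 q = qpoch q N * Pi N Q.
Proof.
elim: N => [|N IH]; first by rewrite !Pi0 qpoch0 mulr1.
rewrite doubleS !PiS IH qpochS -!exprM !mul2n -exprS doubleS; ring.
Qed.

(** This is [qpoch z N] times the Gaussian binomial coefficient of [N + s] over [s] in base [q^2].
    By [tail_mass] it is, up to explicit factors, the law of a sum of [N + 1] geometric
    variables. *)
Definition qnegbin (z : R) N s := qpoch z N * Pi (N + s) Q / (Pi N Q * Pi s Q).

Lemma qnegbin_shift N s : (1 - q ^+ N.*2.+1) * qnegbin q N s = (1 - q) * qnegbin (q ^+ 3) N s.
Proof. by rewrite /qnegbin !mulrA qpoch_shift (mulrC (1 - q ^+ N.*2.+1)). Qed.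

Lemma qnegbin0 z s : qnegbin z 0 s = 1.
Proof. by rewrite /qnegbin qpoch0 Pi0 !mul1r divff // Pi2_neq0. Qed.

Lemma qnegbin_s0 z N : qnegbin z N 0 = qpoch z N.
Proof. by rewrite /qnegbin Pi0 addn0 mulr1 mulfK // Pi2_neq0. Qed.

Lemma qnegbin_pascal z N s :
  qnegbin z N.+1 s.+1 = (1 - z * Q ^+ N) * qnegbin z N s.+1 + Q ^+ N.+1 * qnegbin z N.+1 s.
Proof.
rewrite /qnegbin !addSn !addnS !PiS qpochS.
have := Pi2_neq0 q_free N; have := Pi2_neq0 q_free s.
have := q2_free q_free N; have := q2_free q_free s.
have -> : Q ^+ (N + s).+2 = Q ^+ N.+1 * Q ^+ s.+1 by rewrite -exprD addSn addnS.
by move: (Q ^+ N.+1) (Q ^+ s.+1) => a b c d e f; field; rewrite c d e f.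
Qed.

(* The probability that a sum of N independent geometric variables, of parameters
   z, z q^2, ..., z q^(2N-2), is at least s. *)
Definition tail z N s :=
  if s is s'.+1 then z ^+ s * \sum_(0 <= j < N) Q ^+ j * qnegbin z j s' else 1.

Lemma tailS z N s : tail z N.+1 s.+1 = tail z N s.+1 + z ^+ s.+1 * Q ^+ N * qnegbin z N s.
Proof. by rewrite /tail big_nat_recr //= mulrDr !mulrA. Qed.

Lemma tail0S z s : tail z 0 s.+1 = 0.
Proof. by rewrite /tail big_nil mulr0. Qed.

Lemma tail_shift z N s : tail z N.+1 s - tail z N s.+1 = z ^+ s * qnegbin z N s.
Proof.
case: s => [|s].
  elim: N => [|N IH]; first by rewrite tail0S subr0 qnegbin0 expr0 mulr1.
  rewrite tailS opprD addrA [tail z N.+2 0]/= -[1]/(tail z N.+1 0) IH !qnegbin_s0 qpochS.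
  by rewrite expr1 !expr0; ring.
elim: N => [|N IH].
  by rewrite tailS !tail0S !qnegbin0 expr0; ring.
rewrite tailS [tail z N.+1 s.+2]tailS opprD addrACA IH qnegbin_pascal !exprS; ring.
Qed.

(** Memorylessness of the last variable: it is zero with probability [1 - z * Q ^+ N], and otherwise
    one plus a fresh copy of itself. *)
Lemma tail_recr z N s :
  tail z N.+1 s.+1 = z * Q ^+ N * tail z N.+1 s + (1 - z * Q ^+ N) * tail z N s.+1.
Proof.
have -> : tail z N.+1 s = tail z N s.+1 + z ^+ s * qnegbin z N s.
  by rewrite -tail_shift addrC subrK.
by rewrite tailS exprS; ring.
Qed.

Lemma tail_mass z N s :
  tail z N.+1 s - tail z N.+1 s.+1 = z ^+ s * (1 - z * Q ^+ N) * qnegbin z N s.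
Proof.
have -> : tail z N.+1 s = tail z N s.+1 + z ^+ s * qnegbin z N s.
  by rewrite -tail_shift addrC subrK.
by rewrite tailS exprS; ring.
Qed.

(** Multiplying every parameter by [q^2] multiplies the weight of the value [s] by [q^(2s)]; the
    other factors compare the normalising constants. *)
Lemma tail_tilt N s :
  q ^+ s.*2 * (1 - q ^+ N.*2.+1) * (tail q N s - tail q N s.+1) =
  (1 - q) * (tail (q ^+ 3) N s - tail (q ^+ 3) N s.+1).
Proof.
case: N => [|N].
  case: s => [|s]; last by rewrite !tail0S subr0 !mulr0.
  by rewrite !tail0S /= expr0 expr1 mul1r.
rewrite !tail_mass.
have -> : q ^+ 3 * Q ^+ N = q ^+ N.*2.+3 by rewrite -exprM -exprD mul2n.
have -> : q * Q ^+ N = q ^+ N.*2.+1 by rewrite -exprM mul2n exprS.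
rewrite doubleS mulrCA -[(q ^+ 3) ^+ s * _ * _]mulrA [in RHS]mulrCA [(1 - q) * _]mulrCA.
rewrite -qnegbin_shift.
by rewrite -exprM mulSn mul2n exprD; ring.
Qed.
Lemma tail_0 z N : tail z N 0 = 1. Proof. by []. Qed.
End Tails.
Arguments tail : simpl never.

(** * The closed form, for odd sizes and then for even sizes *)

Section ClosedForm.
Variables (R : fieldType) (q : R) (M : nat) (x : nat -> nat -> R).
Hypothesis q_free : forall j, 1 - q ^+ j.+1 != 0.
Hypothesis x0 : forall n, x n 0%N = 1.
Hypothesis x0S : forall j, (j < M)%N -> x 0 j.+1 = 0.
Hypothesis xE : forall n j, (j <= M)%N ->
  x n j = \sum_(c < n.+1) corank_prob q n c * x c (j - c)%N.
Local Notation tail := (tail q).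

(** The event is [G + 2W >= j]: certain if [W >= uphalf j], while a smaller value [w] of [W] leaves
    probability [q^(j-2w)], whose factor [q^(-2w)] is absorbed by tilting. The proof checks
    [odd_step] for [N = 0], and [odd_two_step] against [tail_recr] beyond. *)
Lemma odd_closed_form N j : (j <= M)%N -> (1 - q) * x N.*2.+1 j =
  q ^+ j * (1 - q ^+ N.*2.+1) * (1 - tail q N (uphalf j)) + (1 - q) * tail (q ^+ 3) N (uphalf j).
Proof.
elim: N j => [|N IHN] j.
  elim: j => [_|j IH jM]; first by rewrite x0 /= !tail_0 subrr mulr0 add0r.
  rewrite (@odd_step R q M x q_free x0 xE 0 j.+1) // double0 x0S // mulr0 add0r.
  rewrite mulrCA /= IH; last exact: ltnW.
  rewrite !tail0S mulr0 addr0 subr0 expr1.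
  case: j {IH jM} => [|j]; first by rewrite /= !tail_0 subrr expr0 expr1; ring.
  by rewrite !tail0S [q ^+ j.+2]exprS; ring.
elim/ltn_ind: j => -[_ _|m IHm mM]; first by rewrite x0 /= !tail_0 subrr mulr0 add0r.
rewrite (@odd_two_step R q M x q_free x0 xE N m.+1) // mulrDr.
rewrite mulrCA (mulrCA (1 - q)) IHN // IHm; [|lia|lia].
have -> : uphalf (m.+1 - 2) = m./2 by case: m {IHm mM} => [|m] //=; rewrite !subSS ?subn0.
rewrite /= !tail_recr //.
have -> : q ^+ 3 * (q ^+ 2) ^+ N = q ^+ N.*2.+3 by rewrite -exprM -exprD mul2n.
have -> : q * (q ^+ 2) ^+ N = q ^+ N.*2.+1 by rewrite -exprM mul2n exprS.
(* For [m = 0] the subtraction [m.+1 - 2] is truncated, so this case is checked apart. *)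
case: m {IHm} mM => [|m] mM.
  by rewrite /= !tail_0 subrr !mulr0 !add0r doubleS !exprS; ring.
have -> : (m.+2 - 2 = m)%N by lia.
rewrite doubleS.
move: (tail _ _ _) (tail _ _ _) (tail _ _ _) (tail _ _ _) => a b c d.
have -> : q ^+ N.*2.+3 = q ^+ 2 * q ^+ N.*2.+1 by rewrite -exprD.
have -> : q ^+ m.+2 = q ^+ 2 * q ^+ m by rewrite -exprD.
ring.
Qed.

Lemma closed_form n j : (0 < n)%N -> (j < M)%N -> (1 - q) * x n j.+1 =
  q ^+ j.+1 * (1 - q ^+ n) * (1 - tail q n./2 j./2.+1) + (1 - q) * tail (q ^+ 3) n./2 j./2.+1.
Proof.
move=> n0 jM; have [on|en] := boolP (odd n).
  have -> : n = n./2.*2.+1 by rewrite -{1}(odd_double_half n) on.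
  by rewrite odd_closed_form //= uphalf_double.
have nE : n = n./2.*2 by rewrite -{1}(odd_double_half n) (negbTE en).
move: n0; rewrite nE doubleK; move: n./2 => N N0.
have h := q_free N.*2.
(* Both [j] and [j.+1] need the same threshold [j./2.+1]. For even [j] this is one more than
   [uphalf j], and [tail_tilt] shows that the closed form does not change. *)
have O : (1 - q) * x N.*2.+1 j = q ^+ j * (1 - q ^+ N.*2.+1) * (1 - tail q N j./2.+1)
    + (1 - q) * tail (q ^+ 3) N j./2.+1.
  rewrite odd_closed_form; last exact: ltnW.
  rewrite uphalf_half; case: (boolP (odd j)) => oj; first by rewrite add1n.
  rewrite add0n; have T := tail_tilt q_free N j./2.
  have ej : j./2.*2 = j by rewrite -[in RHS](odd_double_half j) (negbTE oj).
  rewrite ej in T; apply/eqP; rewrite -subr_eq0; apply/eqP.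
  move: T; move: (tail _ _ _) (tail _ _ _) (tail _ _ _) (tail _ _ _) => a b c d T.
  transitivity ((1 - q) * (b - a) - q ^+ j * (1 - q ^+ N.*2.+1) * (d - c)); first by ring.
  by rewrite T subrr.
apply: (mulfI h).
have E : (1 - q ^+ N.*2.+1) * x N.*2 j.+1 = x N.*2.+1 j.+1 - q ^+ N.*2.+1 * x N.*2.+1 j.
  by rewrite (@odd_step R q M x q_free x0 xE N j.+1) // addrK.
rewrite mulrCA E mulrBr (mulrCA (1 - q)) O odd_closed_form //=.
have -> : q ^+ N.*2.+1 = q * q ^+ N.*2 by rewrite exprS.
by rewrite exprS; ring.
Qed.
End ClosedForm.

(** * Bounds on the remainder *)

Section Bounds.
Variables (R : rcfType) (q : R).
Hypotheses (q_gt0 : 0 < q) (q_half : q * 2 <= 1).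
Local Notation Q := (q ^+ 2).

Lemma q_lt1 : q < 1. Proof. by move: q_gt0 q_half; lra. Qed.

Lemma q_free j : 1 - q ^+ j.+1 != 0.
Proof. by rewrite gt_eqF // subr_gt0 exprn_ilt1 ?q_lt1 // ltW. Qed.

Lemma le_expq i j : (i <= j)%N -> q ^+ j <= q ^+ i.
Proof. by move=> ij; rewrite ler_wiXn2l // ltW // q_lt1. Qed.

Definition weight j s : R := Pi (2 * j) q * Pi (j + s) Q / (Pi j Q ^+ 2 * Pi s Q).

Lemma weightE j s : weight j s = qnegbin q q j s.
Proof.
rewrite /weight /qnegbin mul2n Pi_double.
have := Pi2_neq0 q_free j; have := Pi2_neq0 q_free s => a b.
by field; rewrite a b.
Qed.

Lemma weight_recr j s : weight j.+1 s * (1 - Q ^+ j.+1) =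
  weight j s * ((1 - q ^+ j.*2.+1) * (1 - Q ^+ (j + s).+1)).
Proof.
rewrite !weightE /qnegbin addSn !PiS qpochS -exprM mul2n -exprS.
have := Pi2_neq0 q_free j; have := Pi2_neq0 q_free s; have := q2_free q_free j => a b c.
by field; rewrite a b c.
Qed.

(** The weight starts at 1 and does not increase with [j]: in [weight_recr], [1 - q^(2j+1)] is at
    most [1 - q^(2j+2)]. *)
Lemma weight_bounds j s : 0 <= weight j s <= 1.
Proof.
elim: j => [|j /andP[IH0 IH1]]; first by rewrite weightE (qnegbin0 q_free) ler01 lexx.
have Q1 : 0 < 1 - Q ^+ j.+1.
  by rewrite -exprM mulnS subr_gt0 exprn_ilt1 ?q_lt1 // ltW.
have a0 : 0 <= 1 - q ^+ j.*2.+1 by rewrite subr_ge0 exprn_ile1 // ltW ?q_lt1.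
have b0 : 0 <= 1 - Q ^+ (j + s).+1 by rewrite -exprM subr_ge0 exprn_ile1 // ltW ?q_lt1.
have b1 : 1 - Q ^+ (j + s).+1 <= 1 by rewrite -exprM lerBlDr lerDl exprn_ge0 // ltW.
have aQ : 1 - q ^+ j.*2.+1 <= 1 - Q ^+ j.+1.
  by rewrite lerD2l lerN2 -exprM le_expq // mul2n doubleS.
rewrite -[X in X && _](pmulr_lge0 _ Q1) -[X in _ && X](ler_pM2r Q1) mul1r weight_recr.
apply/andP; split; first exact: mulr_ge0 IH0 (mulr_ge0 a0 b0).
apply: (le_trans _ aQ); rewrite -[leRHS]mul1r.
exact: ler_pM IH0 (mulr_ge0 a0 b0) IH1 (ler_piMr a0 b1).
Qed.

Definition remainder n mu : R :=
  q ^+ (mu.-1)./2.+1 *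
    \sum_(0 <= j < n./2)
      ((q ^+ mu * (1 - q ^+ n) - q ^+ (2 * (mu.-1)./2 + 2)%N * (1 - q ^+ (2 * j + 1)%N))
       * q ^+ (2 * j)%N * weight j (mu.-1)./2).

(** The two tails merge term by term: [qnegbin_shift] turns base [q^3] into base [q] and produces
    the factor [1 - q^(2j+1)]. *)
Lemma remainder_tail n mu : remainder n mu =
  q ^+ mu * (1 - q ^+ n) * tail q q n./2 (mu.-1)./2.+1 -
  (1 - q) * tail q (q ^+ 3) n./2 (mu.-1)./2.+1.
Proof.
rewrite /remainder /tail; set s := (mu.-1)./2.
rewrite !mulr_sumr -sumrB; apply: eq_bigr => j _; rewrite weightE.
rewrite -!(exprM q 2 j) !mul2n addn1.
have -> : (1 - q) * (q ^+ 3 ^+ s.+1 * (q ^+ j.*2 * qnegbin q (q ^+ 3) j s)) =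
    q ^+ 3 ^+ s.+1 * q ^+ j.*2 * ((1 - q ^+ j.*2.+1) * qnegbin q q j s).
  by rewrite qnegbin_shift; ring.
have -> : q ^+ 3 ^+ s.+1 = q ^+ s.+1 * q ^+ (s.*2 + 2).
  by rewrite -exprM -exprD; congr (_ ^+ _); lia.
ring.
Qed.

Lemma remainder_ge0 n mu : 0 <= remainder n mu.
Proof.
have q0 := ltW q_gt0; have q1 := ltW q_lt1.
apply: mulr_ge0; first exact: exprn_ge0.
rewrite big_nat; apply: sumr_ge0 => j /andP[_ jn].
have /andP[w0 _] := weight_bounds j (mu.-1)./2.
apply: mulr_ge0 => //; apply: mulr_ge0; last exact: exprn_ge0.
(* With [s = (mu.-1)./2], this uses [mu <= 2s+2] and [2j+1 <= n]. *)
rewrite subr_ge0; apply: ler_pM; rewrite ?exprn_ge0 ?subr_ge0 ?exprn_ile1 //.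
  by apply: le_expq; lia.
by rewrite lerD2l lerN2; apply: le_expq; lia.
Qed.

Lemma remainder_lt n mu : (0 < mu)%N -> remainder n mu < Num.sqrt (q ^+ (3 * mu)).
Proof.
move=> mu0; have q0 := ltW q_gt0; have q1 := ltW q_lt1.
rewrite -[ltLHS](ger0_norm (remainder_ge0 n mu)) -sqrtr_sqr ltr_sqrt ?exprn_gt0 //.
(* Since [2(s+1) >= mu], the square of this bound is at most [q^(3mu)]. It is reached by comparing
   the sum with a geometric series of ratio [q^2]. *)
suff h : remainder n mu < q ^+ ((mu.-1)./2.+1 + mu).
  apply: (@lt_le_trans _ _ ((q ^+ ((mu.-1)./2.+1 + mu)) ^+ 2)).
    by rewrite ltr_pXn2r // nnegrE ?remainder_ge0 ?exprn_ge0.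
  by rewrite -exprM; apply: le_expq; lia.
rewrite /remainder [ltRHS]exprD ltr_pM2l ?exprn_gt0 //.
have geo k : (\sum_(0 <= j < k) q ^+ (2 * j)) * (1 - q ^+ 2) = 1 - q ^+ (2 * k).
  elim: k => [|k IH]; first by rewrite big_nil mul0r muln0 expr0 subrr.
  by rewrite big_nat_recr //= mulrDl IH mulnS exprD; ring.
apply: (@le_lt_trans _ _ (q ^+ mu * ((\sum_(0 <= j < n./2) q ^+ (2 * j)) * (1 - q ^+ 2))));
  last first.
  by rewrite geo -[ltRHS]mulr1 ltr_pM2l ?exprn_gt0 // ltrBlDr ltrDl exprn_gt0.
rewrite mulr_suml mulr_sumr; rewrite !big_nat; apply: ler_sum => j /andP[_ jn].
have /andP[w0 w1] := weight_bounds j (mu.-1)./2.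
rewrite -[leRHS]mulr1; apply: ler_pM => //.
  apply: mulr_ge0; last exact: exprn_ge0.
  rewrite subr_ge0; apply: ler_pM; rewrite ?exprn_ge0 ?subr_ge0 ?exprn_ile1 //.
    by apply: le_expq; lia.
  by rewrite lerD2l lerN2; apply: le_expq; lia.
rewrite [leRHS]mulrCA [leRHS]mulrC ler_wpM2r ?exprn_ge0 //.
(* The intermediate bound uses [2s+2 <= mu+1]; it is at most [q^mu (1 - q^2)] exactly because
   [q <= 1/2]. *)
apply: (@le_trans _ _ (q ^+ mu - q ^+ mu.+1 * (1 - q))).
  apply: lerB; first by rewrite -[leRHS]mulr1 ler_wpM2l ?exprn_ge0 // lerBlDr lerDl exprn_ge0.
  apply: ler_pM; rewrite ?exprn_ge0 ?subr_ge0 //.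
    by apply: le_expq; lia.
  by rewrite lerD2l lerN2 -[leRHS]expr1; apply: le_expq; lia.
rewrite exprS -subr_ge0.
have -> : q ^+ mu * (1 - q ^+ 2) - (q ^+ mu - q * q ^+ mu * (1 - q)) = q ^+ mu * q * (1 - q * 2).
  by ring.
by rewrite !mulr_ge0 ?exprn_ge0 // subr_ge0.
Qed.
End Bounds.

(** * The ring Z/p^mu *)

Section PrimePower.
Variables (p mu : nat).
Hypotheses (p_pr : prime p) (mu_gt0 : (0 < mu)%N).
Local Notation L := ('Z_(p ^ mu) : finComUnitRingType).
Local Notation nonunit x := (x \isn't a GRing.unit).

Lemma expn_gt1 : (1 < p ^ mu)%N.
Proof. by rewrite -(expn0 p) ltn_exp2l ?prime_gt1. Qed.

Lemma nonunit_natr k : nonunit (k%:R : 'Z_(p ^ mu)) = (p %| k)%N.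
Proof. by rewrite unitZpE ?expn_gt1 // coprime_pexpl // prime_coprime // negbK. Qed.

Lemma nonunitP (x : 'Z_(p ^ mu)) : nonunit x <-> exists y, x = p%:R * y.
Proof.
split=> [|[y ->]]; last by rewrite unitrM negb_and nonunit_natr dvdnn.
rewrite -{1}(natr_Zp x) nonunit_natr => /dvdnP[k e].
by exists k%:R; rewrite -natrM mulnC -e natr_Zp.
Qed.

Lemma nonunit_add (x y : 'Z_(p ^ mu)) : nonunit x -> nonunit y -> nonunit (x + y).
Proof.
by move=> /nonunitP[a ->] /nonunitP[b ->]; apply/nonunitP; exists (a + b); rewrite mulrDr.
Qed.

Lemma card_ZpX : #|'Z_(p ^ mu)| = (p ^ mu)%N.
Proof. by rewrite card_ord Zp_cast // expn_gt1. Qed.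

Lemma card_nonunit_ZpX : #|[pred x : 'Z_(p ^ mu) | nonunit x]| = (p ^ mu.-1)%N.
Proof.
have p0 := prime_gt0 p_pr.
have eM : (p ^ mu = p * p ^ mu.-1)%N by rewrite -expnS prednK.
pose f (k : 'I_(p ^ mu.-1)) : 'Z_(p ^ mu) := (p * k)%:R.
have fE k : f k = (p * k)%N :> nat.
  by rewrite val_Zp_nat ?expn_gt1 // modn_small // eM ltn_pmul2l.
have injf : injective f.
  move=> i j /(congr1 val) /= e; apply/val_inj/eqP; rewrite -(eqn_pmul2l p0).
  by rewrite -!fE e.
rewrite -[RHS]card_ord -(card_imset _ injf); apply: eq_card => x; rewrite inE.
apply/idP/imsetP => [|[k _ ->]]; last by rewrite nonunit_natr dvdn_mulr.
rewrite -{1}(natr_Zp x) nonunit_natr => /dvdnP[k e].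
have hk : (k < p ^ mu.-1)%N.
  rewrite -(ltn_pmul2l p0) -eM mulnC -e.
  by have := leq_trans (ltn_ord x) (eq_leq (Zp_cast expn_gt1)).
by exists (Ordinal hk) => //; rewrite /f /= mulnC -e natr_Zp.
Qed.

Lemma expp_eq0 k : ((p%:R : 'Z_(p ^ mu)) ^+ k == 0) = (mu <= k)%N.
Proof.
rewrite -natrX -val_eqE /= val_Zp_nat ?expn_gt1 // -/(dvdn _ _).
by rewrite dvdn_Pexp2l ?prime_gt1.
Qed.

Lemma symQ_closed_form (R : rcfType) n (q : R) : q = p%:R^-1 -> (0 < n)%N ->
  (1 - q) * symQ R n (p ^ mu) = q ^+ mu * (1 - q ^+ n) - remainder q n mu.
Proof.
move=> qE n0.
have p2 : (2 <= p)%N := prime_gt1 p_pr.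
have pR : 0 < p%:R :> R by rewrite ltr0n prime_gt0.
have q_gt0 : 0 < q by rewrite qE invr_gt0.
have q_half : q * 2 <= 1 by rewrite qE mulrC ler_pdivrMr // mul1r ler_nat.
have qf := q_free q_gt0 q_half.
(* For [j <= mu], divisibility of the determinant by [p^j] means that [p^(mu-j)] kills it. *)
pose F n m j := probdeg R n m ((p%:R : L) ^+ (mu - j)).
have eq_q : #|[pred x : L | nonunit x]|%:R / #|L|%:R = q :> R.
  rewrite card_nonunit_ZpX card_ZpX qE -(prednK mu_gt0) expnS natrM /=.
  by rewrite invfM mulrCA divff ?mulr1 // pnatr_eq0 -lt0n expn_gt0 prime_gt0.
have F0 m j : (j <= mu)%N -> F m 0 j = F m m (j - m)%N.
  move=> jm; rewrite /F (probdeg_scale _ _ _ nonunitP) -exprD.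
  (* If [j < m], the truncated [j - m] is 0 and both multipliers are 0 in the ring. *)
  have [mj|jm'] := leqP m j; first by congr (probdeg _ _ _ (_ ^+ _)); lia.
  congr probdeg; transitivity (0 : L); first by apply/eqP; rewrite expp_eq0; lia.
  by apply/esym/eqP; rewrite expp_eq0; lia.
have F1 m j : (j <= mu)%N -> F m.+1 1 j = (1 - q) * F m 0 j + q * F m.+1 0 j.
  by move=> _; rewrite /F probdeg_recr1 ?eq_q //; exact: nonunit_add.
have FS m k j : (j <= mu)%N -> (k <= m)%N -> F m.+2 k.+2 j = (1 - q) * F m.+1 k.+1 j +
    q * (1 - q ^+ k.+1) * F m k j + q ^+ k.+2 * F m.+2 k.+1 j.
  by move=> _ km; rewrite /F probdeg_recr ?eq_q //; exact: nonunit_add.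
pose x m j := F m m j.
have xE m j : (j <= mu)%N -> x m j = \sum_(c < m.+1) corank_prob q m c * x c (j - c)%N.
  by move=> jm; have := convolution qf F0 F1 FS m 0 jm; rewrite add0n.
have x0 m : x m 0%N = 1.
  rewrite /x /F subn0 (_ : _ ^+ mu = 0) ?probdeg0 //.
  by apply/eqP; rewrite expp_eq0.
have x0S j : (j < mu)%N -> x 0%N j.+1 = 0.
  by move=> jm; rewrite /x /F probdeg00 expp_eq0 (_ : (mu <= _)%N = false) //; lia.
have -> : symQ R n (p ^ mu) = x n mu.
  rewrite /symQ /x /F subnn expr0 /probdeg; congr (_%:R / _%:R); apply: eq_card => A.
    rewrite !inE mul1r; congr (_ && _); rewrite [X in _ = X && _](_ : _ = true) //.
    by apply/forallP=> i; rewrite leqNgt ltn_ord.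
  rewrite !inE mul0r eqxx andbT; rewrite [X in _ = _ && X](_ : _ = true) ?andbT //.
  by apply/forallP=> i; rewrite leqNgt ltn_ord.
have := @closed_form R q mu x qf x0 x0S xE n mu.-1 n0.
rewrite prednK // => -> //; rewrite remainder_tail //; ring.
Qed.
End PrimePower.

Theorem theorem5p2 (R : rcfType) (p n mu : nat) :
  prime p -> (1 <= n)%N -> (1 <= mu)%N ->
  let q : R := (p%:R)^-1 in
  let k := n./2 in
  let s := (mu.-1)./2 in
  let RR : R := q ^+ s.+1 *
    \sum_(0 <= j < k)
      ((q ^+ mu * (1 - q ^+ n) - q ^+ (2 * s + 2)%N * (1 - q ^+ (2 * j + 1)%N))
       * q ^+ (2 * j)%N
       * (Pi (2 * j)%N q * Pi (j + s)%N (q ^+ 2))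
       / (Pi j (q ^+ 2) ^+ 2 * Pi s (q ^+ 2))) in
  symQ R n (p ^ mu) = (q ^+ mu * (1 - q ^+ n) - RR) / (1 - q) /\
  0 <= RR /\ RR < Num.sqrt (q ^+ (3 * mu)%N).
Proof.
move=> p_pr n0 mu0 q k s RR.
have q_gt0 : 0 < q by rewrite invr_gt0 ltr0n prime_gt0.
have q_half : q * 2 <= 1.
  by rewrite mulrC ler_pdivrMr ?ltr0n ?prime_gt0 // mul1r ler_nat prime_gt1.
have -> : RR = remainder q n mu.
  by congr (_ * _); apply: eq_bigr => j _; rewrite /weight !mulrA.
split; last by split; [exact: remainder_ge0|exact: remainder_lt].
rewrite -(symQ_closed_form p_pr mu0 (erefl q) n0) mulrC mulKf //.
by have := q_free q_gt0 q_half 0; rewrite expr1.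
Qed.
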